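(* Let $\{a_n\}_{n\ge1}$ be a sequence of positive real numbers such that $\lim_{n\to\infty}na_n$ exists, is finite and nonzero, let $r=\{r_n\}_{n\ge1}$ be a bounded sequence of strictly positive real numbers, and let $s$ be an $s$-number sequence. If $\sup_i|a_i|r_i=1$, then the mapping $$Q^{(s)}(\phi)=\sup_i\left|a_i\sum_{j=1}^is_j(\phi)\right|r_i,\qquad\phi\in\chi_{c_0(r)}^{(s)},$$ is a quasi-norm on $\chi_{c_0(r)}^{(s)}$, and the operator ideal $\chi_{c_0(r)}^{(s)}$ is complete under the quasi-norm $Q^{(s)}$.
   Context: $\mathbb{N}=\{1,2,\dots\}$. $\mathcal{B}$ is the class of all bounded linear operators between arbitrary Banach spaces, with components $\mathcal{B}(X,Y)$; $X'$ is the dual of $X$; for $x'\in X'$, $y\in Y$, $x'\otimes y:X\to Y$ is $(x'\otimes y)(x)=x'(x)y$. An $s$-number sequence is a map $s:\mathcal{B}\to\mathbb{R}^{\mathbb{N}}$ assigning to each $\phi\in\mathcal{B}$ a non-negative sequence $\{s_n(\phi)\}$ with: (1) $\|\phi\|=s_1(\phi)\ge s_2(\phi)\ge\cdots\ge0$; (2) $s_{m+n-1}(\phi+\psi)\le s_m(\phi)+s_n(\psi)$ for $\phi,\psi\in\mathcal{B}(X,Y)$; (3) $s_n(\zeta\phi\eta)\le\|\zeta\|s_n(\phi)\|\eta\|$ for $\eta\in\mathcal{B}(X_0,X)$, $\phi\in\mathcal{B}(X,Y)$, $\zeta\in\mathcal{B}(Y,Y_0)$; (4) $s_n(\phi)=0$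 if $\operatorname{rank}(\phi)<n$; (5) $s_n(I:\ell_2^{(n)}\to\ell_2^{(n)})=1$, where $I$ is the identity operator on the $n$-dimensional Hilbert space $\ell_2^{(n)}$. The class $\chi_{c_0(r)}^{(s)}$ has components, for Banach spaces $X,Y$, $$\chi_{c_0(r)}^{(s)}(X,Y)=\Big\{\phi\in\mathcal{B}(X,Y):\lim_{i\to\infty}\Big(a_i\sum_{j=1}^is_j(\phi)\Big)r_i=0\Big\}.$$ A class $\mathcal{A}=\bigcup_{X,Y}\mathcal{A}(X,Y)$ with $\mathcal{A}(X,Y)\subseteq\mathcal{B}(X,Y)$ is an operator ideal if, for all Banach spaces: $x'\otimes y\in\mathcal{A}(X,Y)$ for $x'\in X'$, $y\in Y$; $\phi+\psi\in\mathcal{A}(X,Y)$ for $\phi,\psi\in\mathcal{A}(X,Y)$; and $\zeta\phi\eta\in\mathcal{A}(X_0,Y_0)$ for $\eta\in\mathcal{B}(X_0,X)$, $\phi\in\mathcal{A}(X,Y)$, $\zeta\in\mathcal{B}(Y,Y_0)$. A function $\Gamma$ assigning to every $\phi\in\mathcal{A}$ a non-negative real number is a quasi-norm on the operator ideal $\mathcal{A}$ if: $\Gamma(x'\otimes y)=\|x'\|\|y\|$ for $x'\in X'$, $y\in Y$; there is a constant $c\ge1$ with $\Gamma(\phi+\psi)\le c(\Gamma(\phi)+\Gamma(\psi))$ for $\phi,\psi\in\mathcal{A}(X,Y)$; and $\Gamma(\zeta\phi\eta)\le\|\zeta\|\Gamma(\phi)\|\eta\|$ for $\eta\in\mathcal{B}(X_0,X)$,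 $\phi\in\mathcal{A}(X,Y)$, $\zeta\in\mathcal{B}(Y,Y_0)$. Complete under $Q^{(s)}$ means that, for all Banach spaces $X,Y$, every sequence in $\chi_{c_0(r)}^{(s)}(X,Y)$ that is Cauchy with respect to $Q^{(s)}$ (i.e. $Q^{(s)}(\phi_n-\phi_m)\to0$) converges with respect to $Q^{(s)}$ to an element of $\chi_{c_0(r)}^{(s)}(X,Y)$. *)

(* Defs.v *)
From HB Require Import structures.
From mathcomp Require Import all_boot all_order all_algebra.
From mathcomp Require Import complex.
From mathcomp Require Import boolp classical_sets functions reals ereal.
From mathcomp Require Import topology normedtype sequences.
From mathcomp Require Import ring lra.

Set Implicit Arguments.
Unset Strict Implicit.
Unset Printing Implicit Defensive.

Import Order.TTheory GRing.Theory Num.Theory.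
Import numFieldNormedType.Exports.

Local Open Scope classical_set_scope.
Local Open Scope ring_scope.

Variant scalars := RealScalars | ComplexScalars.

Definition scalar_field (R : realType) (c : scalars) : numFieldType :=
  match c with RealScalars => R | ComplexScalars => R[i] end.

Definition re (R : realType) (c : scalars) : scalar_field R c -> R :=
  match c with RealScalars => id | ComplexScalars => @complex.Re R end.

Definition im (R : realType) (c : scalars) : scalar_field R c -> R :=
  match c with RealScalars => fun=> 0 | ComplexScalars => @complex.Im R end.

(* [of_reim x y] is x + iy over C, and x over R. *)
Definition of_reim (R : realType) (c : scalars) : R -> R -> scalar_field R c :=
  match c with
  | RealScalars => fun x _ => x
  | ComplexScalars => fun x y => Complex x y
  end.

(* In the library the norm of a normed space over K takes its values in K;
   [rnorm] is the same norm with values in R. *)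
Definition rnorm (R : realType) (c : scalars)
  (V : normedZmodType (scalar_field R c)) (x : V) : R := re `|x|.

Section RealNorm.
Variables (R : realType) (c : scalars).
Local Notation K := (scalar_field R c).

Lemma reD : {morph @re R c : x y / x + y}.
Proof. by case: c => //= -[x1 x2] [y1 y2]. Qed.

Lemma imD : {morph @im R c : x y / x + y}.
Proof. by case: c => /= [x y|[x1 x2] [y1 y2]//]; rewrite addr0. Qed.

Lemma reN : {morph @re R c : x / - x}.
Proof. by case: c => //= -[x1 x2]. Qed.

Lemma imN : {morph @im R c : x / - x}.
Proof. by case: c => /= [x|[x1 x2]//]; rewrite oppr0. Qed.

Lemma re_of (x y : R) : re (of_reim c x y) = x.
Proof. by case: c. Qed.

Lemma reim_inj (x y : K) : re x = re y -> im x = im y -> x = y.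
Proof. by move: x y; case: c => //= -[x1 x2] [y1 y2] /= -> ->. Qed.

Lemma of_reim0 (x : K) : 0 <= x -> x = of_reim c (re x) 0.
Proof.
by move: x; case: c => //= -[x1 x2]; rewrite lecE /= => /andP[/eqP -> _].
Qed.

Lemma of_realD (x y : R) : of_reim c (x + y) 0 = of_reim c x 0 + of_reim c y 0.
Proof. by case: c => //=; apply/eqP; rewrite eq_complex /= addr0 !eqxx. Qed.

Lemma of_realM (x y : R) : of_reim c (x * y) 0 = of_reim c x 0 * of_reim c y 0.
Proof.
case: c => //=; apply/eqP; rewrite eq_complex /= !mulr0 !mul0r subr0 addr0.
by rewrite !eqxx.
Qed.

Lemma of_real_le (x y : R) : (of_reim c x 0 <= of_reim c y 0) = (x <= y).
Proof. by case: c => //=; rewrite lecE /= eqxx. Qed.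

Lemma of_real_lt (x y : R) : (of_reim c x 0 < of_reim c y 0) = (x < y).
Proof. by case: c => //=; rewrite ltcE /= eqxx. Qed.

Lemma of_real0 : of_reim c (0 : R) 0 = 0.
Proof. by case: c. Qed.

Lemma of_real_rnorm (V : normedZmodType K) (x : V) :
  of_reim c (rnorm x) 0 = `|x|.
Proof. by rewrite /rnorm -of_reim0. Qed.

Lemma rnorm_ge0 (V : normedZmodType K) (x : V) : 0 <= rnorm x.
Proof. by rewrite -of_real_le of_real_rnorm of_real0. Qed.

Lemma rnorm0 (V : normedZmodType K) : rnorm (0 : V) = 0.
Proof. by rewrite /rnorm normr0 -of_real0 re_of. Qed.

Lemma rnormD (V : normedZmodType K) (x y : V) :
  rnorm (x + y) <= rnorm x + rnorm y.
Proof. by rewrite -of_real_le of_realD !of_real_rnorm ler_normD. Qed.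

Lemma rnormN (V : normedZmodType K) (x : V) : rnorm (- x) = rnorm x.
Proof. by rewrite /rnorm normrN. Qed.

Lemma rnormZ (V : normedModType K) (k : K) (x : V) :
  rnorm (k *: x) = rnorm k * rnorm x.
Proof.
by rewrite /rnorm -[RHS](re_of _ 0) of_realM !of_real_rnorm normrZ.
Qed.

Lemma rnormM (k l : K) : rnorm (k * l) = rnorm k * rnorm l.
Proof. by rewrite /rnorm -[RHS](re_of _ 0) of_realM !of_real_rnorm normrM. Qed.

Lemma rnorm_eq0 (V : normedZmodType K) (x : V) : rnorm x = 0 -> x = 0.
Proof.
by move=> x0; apply/eqP; rewrite -normr_eq0 -of_real_rnorm x0 of_real0.
Qed.

Lemma rnorm_sqr (x : K) : rnorm x ^+ 2 = re x ^+ 2 + im x ^+ 2.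
Proof.
move: x; rewrite /rnorm; case: c => /= [x|[x y]].
  by rewrite real_normK ?num_real// expr0n addr0.
by rewrite sqr_sqrtr ?addr_ge0 ?sqr_ge0.
Qed.

Lemma re_le_rnorm (x : K) : `|re x| <= rnorm x.
Proof.
rewrite -[leRHS]ger0_norm ?rnorm_ge0// -!sqrtr_sqr ler_wsqrtr//.
by rewrite rnorm_sqr lerDl sqr_ge0.
Qed.

Lemma im_le_rnorm (x : K) : `|im x| <= rnorm x.
Proof.
rewrite -[leRHS]ger0_norm ?rnorm_ge0// -!sqrtr_sqr ler_wsqrtr//.
by rewrite rnorm_sqr lerDr sqr_ge0.
Qed.

Lemma rnorm_le_reim (x : K) : rnorm x <= `|re x| + `|im x|.
Proof.
rewrite -(@ler_pXn2r _ 2)// ?nnegrE ?addr_ge0 ?rnorm_ge0//.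
rewrite rnorm_sqr sqrrD !real_normK ?num_real//.
by rewrite -addrA lerD2l lerDr mulrn_wge0// mulr_ge0.
Qed.

Lemma im_of_lim (T : Type) (F : set_system T) (FF : ProperFilter F)
    (g : T -> K) (x : R) :
  im (of_reim c x (lim ((fun t => im (g t)) @ F))) =
  lim ((fun t => im (g t)) @ F).
Proof. by move: g; case: c => //= g; rewrite lim_cst. Qed.

End RealNorm.

Section EuclideanNorm.
Variables (R : realType) (n : nat).
Implicit Types u v : 'I_n -> R.

Lemma sum_sqr_ge0 u : 0 <= \sum_i u i ^+ 2.
Proof. by apply: sumr_ge0 => i _; rewrite sqr_ge0. Qed.

Lemma cauchy_schwarz_sum u v :
  \sum_i u i * v i
  <= Num.sqrt (\sum_i u i ^+ 2) * Num.sqrt (\sum_i v i ^+ 2).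
Proof.
set A := Num.sqrt _; set B := Num.sqrt _.
have A0 : 0 <= A by exact: sqrtr_ge0.
have B0 : 0 <= B by exact: sqrtr_ge0.
have AE : A ^+ 2 = \sum_i u i ^+ 2 by rewrite sqr_sqrtr ?sum_sqr_ge0.
have BE : B ^+ 2 = \sum_i v i ^+ 2 by rewrite sqr_sqrtr ?sum_sqr_ge0.
have zero (w : 'I_n -> R) : \sum_i w i ^+ 2 = 0 -> forall i, w i = 0.
  move=> /eqP; rewrite psumr_eq0; last by move=> i _; exact: sqr_ge0.
  move=> /allP w0 i; have /w0 : i \in index_enum 'I_n by rewrite mem_index_enum.
  by rewrite /= sqrf_eq0 => /eqP.
have [/eqP A00|Ap] := boolP (A == 0).
  rewrite A00 mul0r big1// => i _; rewrite (zero u) ?mul0r//.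
  by rewrite -AE A00 expr0n.
have [/eqP B00|Bp] := boolP (B == 0).
  rewrite B00 mulr0 big1// => i _; rewrite (zero v) ?mulr0//.
  by rewrite -BE B00 expr0n.
have ABp : 0 < A * B by rewrite mulr_gt0// lt0r ?Ap ?Bp.
have H : 0 <= \sum_i (B * u i - A * v i) ^+ 2 by exact: sum_sqr_ge0.
have E : \sum_i (B * u i - A * v i) ^+ 2 =
    B ^+ 2 * (\sum_i u i ^+ 2) + A ^+ 2 * (\sum_i v i ^+ 2)
    - 2 * (A * B) * \sum_i u i * v i.
  rewrite !mulr_sumr -big_split -sumrB /=; apply: eq_bigr => i _; ring.
move: H; rewrite E -AE -BE.
set S := \sum_i _ => H.
rewrite -(ler_pM2l ABp); nra.
Qed.

Lemma minkowski_sum u v : (forall i, 0 <= u i) -> (forall i, 0 <= v i) ->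
  Num.sqrt (\sum_i (u i + v i) ^+ 2)
  <= Num.sqrt (\sum_i u i ^+ 2) + Num.sqrt (\sum_i v i ^+ 2).
Proof.
move=> u0 v0.
rewrite -[leRHS]ger0_norm ?addr_ge0 ?sqrtr_ge0// -sqrtr_sqr ler_wsqrtr//.
have -> : \sum_i (u i + v i) ^+ 2 =
    \sum_i u i ^+ 2 + \sum_i v i ^+ 2 + 2 * \sum_i u i * v i.
  rewrite mulr_sumr -!big_split /=; apply: eq_bigr => i _; ring.
have := cauchy_schwarz_sum u v.
rewrite sqrrD !sqr_sqrtr ?sum_sqr_ge0// => H.
rewrite -mulr_natl; lra.
Qed.

End EuclideanNorm.

Definition ell2 (R : realType) (c : scalars) (n : nat) : Type :=
  'rV[scalar_field R c]_n.

Section Ell2.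
Variables (R : realType) (c : scalars) (n : nat).
Local Notation K := (scalar_field R c).
Local Notation E := (ell2 R c n).

HB.instance Definition _ := GRing.Lmodule.copy E 'rV[K]_n.

Definition ell2_coord (x : E) (i : 'I_n) : K := (x : 'rV[K]_n) ord0 i.

Definition ell2_rnorm (x : E) : R :=
  Num.sqrt (\sum_(i < n) rnorm (ell2_coord x i) ^+ 2).

Definition ell2_norm (x : E) : K := of_reim c (ell2_rnorm x) 0.

Let ell2_normD (x y : E) : ell2_norm (x + y) <= ell2_norm x + ell2_norm y.
Proof.
rewrite /ell2_norm -of_realD of_real_le.
apply: le_trans (minkowski_sum _ _); last 2 first.
- by move=> i; exact: rnorm_ge0.
- by move=> i; exact: rnorm_ge0.
apply: ler_wsqrtr; apply: ler_sum => i _.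
rewrite lerXn2r ?nnegrE ?addr_ge0 ?rnorm_ge0//.
by rewrite {1}/ell2_coord mxE rnormD.
Qed.

Let ell2_normZ (l : K) (x : E) : ell2_norm (l *: x) = `|l| * ell2_norm x.
Proof.
rewrite /ell2_norm -of_real_rnorm -of_realM; congr of_reim.
have l0 := rnorm_ge0 l.
rewrite -[X in X * _](ger0_norm l0) -sqrtr_sqr -sqrtrM ?sqr_ge0//.
congr Num.sqrt; rewrite mulr_sumr; apply: eq_bigr => i _.
by rewrite {1}/ell2_coord mxE rnormM exprMn.
Qed.

Let ell2_norm0 (x : E) : ell2_norm x = 0 -> x = 0.
Proof.
move=> /(congr1 (@re R c)); rewrite /ell2_norm re_of -of_real0 re_of.
move=> /eqP; rewrite sqrtr_eq0 => H.
apply/rowP => i; rewrite mxE.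
have /eqP : \sum_(i < n) rnorm (ell2_coord x i) ^+ 2 = 0.
  by apply/eqP; rewrite eq_le H sumr_ge0// => j _; rewrite sqr_ge0.
rewrite psumr_eq0; last by move=> j _; exact: sqr_ge0.
move=> /allP/(_ i); rewrite mem_index_enum => /(_ isT).
by rewrite sqrf_eq0 => /eqP/rnorm_eq0.
Qed.

HB.instance Definition _ :=
  Lmodule_isNormed.Build K E ell2_normD ell2_normZ ell2_norm0.

Lemma rnorm_ell2 (x : E) : rnorm x = ell2_rnorm x.
Proof. by rewrite /rnorm /Num.norm/= /ell2_norm re_of. Qed.

Lemma ell2_coord_le (x : E) i : rnorm (ell2_coord x i) <= rnorm x.
Proof.
rewrite rnorm_ell2 -[leLHS]ger0_norm ?rnorm_ge0// -sqrtr_sqr ler_wsqrtr//.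
by rewrite (bigD1 i)//= lerDl sumr_ge0// => j _; rewrite sqr_ge0.
Qed.

Lemma ell2_norm_le_sum (x : E) :
  rnorm x <= \sum_i (`|re (ell2_coord x i)| + `|im (ell2_coord x i)|).
Proof.
apply: (@le_trans _ _ (\sum_i rnorm (ell2_coord x i))); last first.
  by apply: ler_sum => i _; exact: rnorm_le_reim.
rewrite rnorm_ell2 -[leRHS]ger0_norm; last first.
  by apply: sumr_ge0 => i _; exact: rnorm_ge0.
rewrite -sqrtr_sqr ler_wsqrtr// expr2 mulr_suml; apply: ler_sum => i _.
rewrite expr2 ler_wpM2l ?rnorm_ge0// (bigD1 i)//= lerDl sumr_ge0// => j _.
exact: rnorm_ge0.
Qed.

Let ell2_complete (F : set_system E) : ProperFilter F -> cauchy F -> cvg F.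
Proof.
move=> FF /cauchy_ballP Fc.
have coord_cvg (g : E -> R) : (forall x y, `|g x - g y| <= rnorm (x - y)) ->
    cvg (g @ F).
  move=> gL; apply: R_complete; apply/cauchy_ballP => e e0.
  have := Fc (of_reim c e 0); rewrite -of_real0 of_real_lt => /(_ e0).
  move=> H; rewrite near_map2; apply: filterS H => -[x y] /=.
  rewrite -!ball_normE /= => xy; apply: le_lt_trans (gL _ _) _.
  by rewrite -(of_real_lt c) of_real_rnorm.
have coordB (x y : E) i : ell2_coord (x - y) i = ell2_coord x i - ell2_coord y i.
  by rewrite /ell2_coord !mxE.
have reB (x y : K) : re x - re y = re (x - y) by rewrite reD reN.
have imB (x y : K) : im x - im y = im (x - y) by rewrite imD imN.
have reC i : cvg ((fun x : E => re (ell2_coord x i)) @ F).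
  apply: coord_cvg => x y; rewrite reB -coordB.
  exact: le_trans (re_le_rnorm _) (ell2_coord_le _ _).
have imC i : cvg ((fun x : E => im (ell2_coord x i)) @ F).
  apply: coord_cvg => x y; rewrite imB -coordB.
  exact: le_trans (im_le_rnorm _) (ell2_coord_le _ _).
pose lr i := lim ((fun x : E => re (ell2_coord x i)) @ F).
pose li i := lim ((fun x : E => im (ell2_coord x i)) @ F).
pose l : E := (\row_i of_reim c (lr i) (li i) : 'rV[K]_n).
have imli i : im (ell2_coord l i) = li i.
  by rewrite {1}/ell2_coord mxE im_of_lim.
have reli i : re (ell2_coord l i) = lr i by rewrite /ell2_coord mxE re_of.
have S0 : (\sum_i (`|re (ell2_coord (l - x) i)| + `|im (ell2_coord (l - x) i)|))
    @[x --> F] --> (0 : R).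
  rewrite -[X in _ --> X](_ : \sum_(i < n) (0 + 0) = 0 :> R); last first.
    by rewrite big1// => i _; rewrite addr0.
  apply: cvg_big => [|i _]; [exact: add_continuous|apply: cvgD].
    under eq_fun do rewrite coordB -reB reli.
    rewrite -(normr0 R) -(subrr (lr i)).
    by apply: cvg_norm; apply: cvgB; [exact: cvg_cst|exact: reC].
  under eq_fun do rewrite coordB -imB imli.
  rewrite -(normr0 R) -(subrr (li i)).
  by apply: cvg_norm; apply: cvgB; [exact: cvg_cst|exact: imC].
apply/cvg_ex; exists l; apply/cvgrPdist_lt => e e0.
have ee := of_reim0 (ltW e0).
have re0 : 0 < re e by rewrite -(of_real_lt c) -ee of_real0.
near=> x.
rewrite ee -of_real_rnorm of_real_lt.
apply: le_lt_trans (ell2_norm_le_sum _) _.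
near: x.
have /cvgrPdist_lt/(_ _ re0) := S0.
apply: filterS => x /=; rewrite sub0r normrN; apply: le_lt_trans.
exact: ler_norm.
Unshelve. all: by end_near. Qed.

HB.instance Definition _ := Uniform_isComplete.Build E ell2_complete.

End Ell2.

Record blin (R : realType) (c : scalars)
    (X Y : normedModType (scalar_field R c)) := BLin {
  blin_fun :> {linear X -> Y} ;
  blin_bounded : exists M : R, forall x : X, rnorm (blin_fun x) <= M * rnorm x
}.

Definition opnorm (R : realType) (c : scalars)
    (X Y : normedModType (scalar_field R c)) (phi : blin X Y) : R :=
  sup [set rnorm (phi x) | x in [set x : X | rnorm x <= 1]].

Section BlinOps.
Variables (R : realType) (c : scalars).
Local Notation K := (scalar_field R c).
Implicit Types X Y Z : normedModType K.

Lemma blin_bounded_ge0 X Y (phi : blin X Y) :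
  exists2 M : R, 0 <= M & forall x, rnorm (phi x) <= M * rnorm x.
Proof.
have [M MP] := blin_bounded phi; exists `|M| => // x.
by apply: le_trans (MP x) _; rewrite ler_wpM2r ?rnorm_ge0 ?ler_norm.
Qed.

Lemma blin_add_subproof X Y (phi psi : blin X Y) :
  exists M : R, forall x, rnorm ((phi \+ psi) x) <= M * rnorm x.
Proof.
have [M MP] := blin_bounded phi; have [N NP] := blin_bounded psi.
exists (M + N) => x /=; apply: le_trans (rnormD _ _) _.
by rewrite mulrDl lerD.
Qed.

Definition blin_add X Y (phi psi : blin X Y) : blin X Y :=
  BLin (blin_add_subproof phi psi).

Lemma blin_sub_subproof X Y (phi psi : blin X Y) :
  exists M : R, forall x, rnorm ((phi \- psi) x) <= M * rnorm x.
Proof.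
have [M MP] := blin_bounded phi; have [N NP] := blin_bounded psi.
exists (M + N) => x /=; apply: le_trans (rnormD _ _) _.
by rewrite rnormN mulrDl lerD.
Qed.

Definition blin_sub X Y (phi psi : blin X Y) : blin X Y :=
  BLin (blin_sub_subproof phi psi).

Lemma blin_comp_subproof X Y Z (zeta : blin Y Z) (phi : blin X Y) :
  exists M : R, forall x, rnorm ((zeta \o phi) x) <= M * rnorm x.
Proof.
have [M M0 MP] := blin_bounded_ge0 zeta; have [N NP] := blin_bounded phi.
exists (M * N) => x /=; apply: le_trans (MP _) _.
by rewrite -mulrA ler_wpM2l.
Qed.

Definition blin_comp X Y Z (zeta : blin Y Z) (phi : blin X Y) : blin X Z :=
  BLin (blin_comp_subproof zeta phi).

Lemma blin_id_subproof X :
  exists M : R, forall x : X, rnorm (idfun x) <= M * rnorm x.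
Proof. by exists 1 => x; rewrite mul1r. Qed.

Definition blin_id X : blin X X := BLin (@blin_id_subproof X).

Definition dual X := blin X K^o.

Definition tensor_fun X Y (f : dual X) (y : Y) : X -> Y :=
  fun x => (f x : K) *: y.

Lemma tensor_fun_linear X Y (f : dual X) (y : Y) : linear (tensor_fun f y).
Proof.
by move=> k u v; rewrite /tensor_fun linearP scalerDl -scalerA.
Qed.

HB.instance Definition _ X Y (f : dual X) (y : Y) :=
  GRing.isLinear.Build K X Y *:%R (tensor_fun f y) (tensor_fun_linear f y).

Lemma tensor_subproof X Y (f : dual X) (y : Y) :
  exists M : R, forall x, rnorm (tensor_fun f y x) <= M * rnorm x.
Proof.
have [M MP] := blin_bounded f; exists (M * rnorm y) => x.
by rewrite rnormZ mulrAC ler_wpM2r ?rnorm_ge0// MP.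
Qed.

Definition tensor X Y (f : dual X) (y : Y) : blin X Y :=
  BLin (tensor_subproof f y).

(* The range of phi has a basis with m elements. *)
Definition has_rank X Y (phi : blin X Y) (m : nat) : Prop :=
  exists b : 'I_m -> Y,
    (forall k : 'I_m -> K, \sum_i k i *: b i = 0 -> forall i, k i = 0) /\
    range phi = [set y | exists k : 'I_m -> K, y = \sum_i k i *: b i].

Definition rank_lt X Y (phi : blin X Y) (n : nat) : Prop :=
  exists2 m, (m < n)%N & has_rank phi m.

End BlinOps.

(* Sequences indexed by {1, 2, ...} are functions on nat of which the value
   at 0 is never used. *)

Section Ideals.
Variables (R : realType) (c : scalars).
Local Notation K := (scalar_field R c).
Local Notation banach := (completeNormedModType K).

Record is_snumber (s : forall X Y : banach, blin X Y -> nat -> R) : Prop := {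
  snumber_1 : forall (X Y : banach) (phi : blin X Y),
    s X Y phi 1%N = opnorm phi ;
  snumber_noninc : forall (X Y : banach) (phi : blin X Y) n, (1 <= n)%N ->
    s X Y phi n.+1 <= s X Y phi n ;
  snumber_ge0 : forall (X Y : banach) (phi : blin X Y) n, (1 <= n)%N ->
    0 <= s X Y phi n ;
  snumber_add : forall (X Y : banach) (phi psi : blin X Y) m n,
    (1 <= m)%N -> (1 <= n)%N ->
    s X Y (blin_add phi psi) (m + n - 1)%N <= s X Y phi m + s X Y psi n ;
  snumber_comp : forall (X0 X Y Y0 : banach)
      (zeta : blin Y Y0) (phi : blin X Y) (eta : blin X0 X) n, (1 <= n)%N ->
    s X0 Y0 (blin_comp zeta (blin_comp phi eta)) n
      <= opnorm zeta * s X Y phi n * opnorm eta ;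
  snumber_rank : forall (X Y : banach) (phi : blin X Y) n, (1 <= n)%N ->
    rank_lt phi n -> s X Y phi n = 0 ;
  snumber_id : forall n, (1 <= n)%N ->
    s (ell2 R c n) (ell2 R c n) (blin_id (ell2 R c n)) n = 1
}.

Record is_operator_ideal (A : forall X Y : banach, set (blin X Y)) : Prop := {
  ideal_tensor : forall (X Y : banach) (f : dual X) (y : Y),
    A X Y (tensor f y) ;
  ideal_add : forall (X Y : banach) (phi psi : blin X Y),
    A X Y phi -> A X Y psi -> A X Y (blin_add phi psi) ;
  ideal_comp : forall (X0 X Y Y0 : banach)
      (zeta : blin Y Y0) (phi : blin X Y) (eta : blin X0 X),
    A X Y phi -> A X0 Y0 (blin_comp zeta (blin_comp phi eta))
}.

(* [Gamma] is extended-real valued, so that its finiteness on [A] is part of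
   the definition; its values outside [A] are irrelevant. *)
Record is_quasi_norm (A : forall X Y : banach, set (blin X Y))
    (Gamma : forall X Y : banach, blin X Y -> \bar R) : Prop := {
  quasi_norm_fin : forall (X Y : banach) (phi : blin X Y), A X Y phi ->
    Gamma X Y phi \is a fin_num ;
  quasi_norm_ge0 : forall (X Y : banach) (phi : blin X Y), A X Y phi ->
    (0 <= Gamma X Y phi)%E ;
  quasi_norm_tensor : forall (X Y : banach) (f : dual X) (y : Y),
    Gamma X Y (tensor f y) = (opnorm f * rnorm y)%:E ;
  quasi_norm_add : exists2 k : R, 1 <= k &
    forall (X Y : banach) (phi psi : blin X Y), A X Y phi -> A X Y psi ->
      (Gamma X Y (blin_add phi psi) <= k%:E * (Gamma X Y phi + Gamma X Y psi))%E ;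
  quasi_norm_comp : forall (X0 X Y Y0 : banach)
      (zeta : blin Y Y0) (phi : blin X Y) (eta : blin X0 X), A X Y phi ->
    (Gamma X0 Y0 (blin_comp zeta (blin_comp phi eta))
      <= (opnorm zeta)%:E * Gamma X Y phi * (opnorm eta)%:E)%E
}.

Definition quasi_complete (A : forall X Y : banach, set (blin X Y))
    (Gamma : forall X Y : banach, blin X Y -> \bar R) : Prop :=
  forall (X Y : banach) (u : nat -> blin X Y), (forall n, A X Y (u n)) ->
    (forall e : R, 0 < e -> exists N : nat, forall m n : nat,
      (N <= m)%N -> (N <= n)%N -> (Gamma X Y (blin_sub (u n) (u m)) < e%:E)%E) ->
    exists2 phi : blin X Y, A X Y phi &
      (Gamma X Y (blin_sub (u n) phi) @[n --> \oo] --> 0%E).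

Definition chi (a r : nat -> R) (s : forall X Y : banach, blin X Y -> nat -> R)
    (X Y : banach) : set (blin X Y) :=
  [set phi | (a i * \sum_(1 <= j < i.+1) s X Y phi j) * r i @[i --> \oo]
               --> (0 : R)].

Definition Qs (a r : nat -> R) (s : forall X Y : banach, blin X Y -> nat -> R)
    (X Y : banach) (phi : blin X Y) : \bar R :=
  ereal_sup [set (`|a i * \sum_(1 <= j < i.+1) s X Y phi j| * r i)%:E
            | i in [set i : nat | (1 <= i)%N]].

End Ideals.

(* Main.v *)
From HB Require Import structures.
Require Import Defs.
From mathcomp Require Import all_boot all_order all_algebra.
From mathcomp Require Import boolp classical_sets functions reals ereal.
From mathcomp Require Import topology normedtype sequences.
From mathcomp Require Import lra.
Import Order.TTheory GRing.Theory Num.Theory.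
Import numFieldNormedType.Exports.
Local Open Scope classical_set_scope.
Local Open Scope ring_scope.

(* Since n a_n converges and r is bounded, C := sup_i i a_i r_i is finite; as
   s_j(phi) <= |phi|, this gives a_1 r_1 |phi| <= Q(phi) <= C |phi|, so Q is
   equivalent to the operator norm and completeness reduces to that of B(X, Y).
   The limit of a sequence of the class stays in the class because
   s_j(phi) <= s_j(psi) + |phi - psi|. *)

Set Implicit Arguments.
Unset Strict Implicit.
Unset Printing Implicit Defensive.

(** * Real-valued norms and convergence over both scalar fields *)

Section RealNormedSpaces.
Variables (R : realType) (c : scalars).
Local Notation K := (scalar_field R c).

Lemma of_real1 : of_reim c (1 : R) 0 = 1.
Proof. by case: c. Qed.

Lemma rnorm_of_real (t : R) : 0 <= t -> rnorm (of_reim c t 0) = t.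
Proof. by move=> t0; rewrite /rnorm ger0_norm ?re_of// -of_real0 of_real_le. Qed.

Lemma rnormB (V : normedZmodType K) (x y : V) : rnorm (x - y) = rnorm (y - x).
Proof. by rewrite -rnormN opprB. Qed.

(** Normalisation: [k *: x] is a unit vector, so a bound on the unit ball extends to [x] by
    homogeneity. *)
Lemma rnorm_neq0 (V : normedModType K) (x : V) :
  rnorm x != 0 -> exists2 k : K, rnorm k = (rnorm x)^-1 &
    x = of_reim c (rnorm x) 0 *: (k *: x).
Proof.
move=> x0; exists (of_reim c (rnorm x)^-1 0).
  by rewrite rnorm_of_real// invr_ge0 rnorm_ge0.
by rewrite scalerA -of_realM divff// of_real1 scale1r.
Qed.

(** A positive element of [K] is real, so tolerances in [K] and in [R] correspond through
    [of_reim c e 0]. *)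
Lemma cvg_rnormP (V : normedModType K) (u : nat -> V) (l : V) :
  u @ \oo --> l <-> forall e : R, 0 < e -> \forall n \near \oo, rnorm (l - u n) < e.
Proof.
split=> [/cvgrPdist_lt ul e e0|ul].
  have := ul (of_reim c e 0); rewrite -of_real0 of_real_lt => /(_ e0).
  by apply: filterS => n; rewrite -of_real_rnorm of_real_lt.
apply/cvgrPdist_lt => e e0; have ee := of_reim0 (ltW e0).
have re0 : 0 < re e by rewrite -(of_real_lt c) -ee of_real0.
by apply: filterS (ul _ re0) => n un; rewrite ee -of_real_rnorm of_real_lt.
Qed.

Lemma rnorm_cauchy_cvg (V : completeNormedModType K) (u : nat -> V) :
  (forall e : R, 0 < e -> exists N : nat, forall m n : nat,
     (N <= m)%N -> (N <= n)%N -> rnorm (u n - u m) < e) ->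
  cvg (u @ \oo).
Proof.
move=> uc; apply: cauchy_cvg; apply/cauchy_ballP => e e0.
have ee := of_reim0 (ltW e0).
have re0 : 0 < re e by rewrite -(of_real_lt c) -ee of_real0.
have [N NP] := uc _ re0.
rewrite near_map2; exists ([set n | (N <= n)%N], [set n | (N <= n)%N]).
  by split; exists N.
move=> [m n] [/= Nm Nn]; rewrite -ball_normE /= ee -of_real_rnorm of_real_lt.
exact: NP.
Qed.

Lemma blin_ext (X Y : normedModType K) (phi psi : blin X Y) :
  phi =1 psi -> phi = psi.
Proof.
case: phi psi => [[f [[fa] [fb]]] fP] [[g [[ga] [gb]]] gP] /= /funext fg.
move: fa fb fP; rewrite {}fg => fa fb fP.
by rewrite (Prop_irrelevance fa ga) (Prop_irrelevance fb gb) (Prop_irrelevance fP gP).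
Qed.

(** * The operator norm *)

Section OperatorNorm.
Variables (X Y : normedModType K).
Implicit Types phi psi : blin X Y.

Lemma rnorm_le_opnorm phi x : rnorm (phi x) <= opnorm phi * rnorm x.
Proof.
have [M M0 MP] := blin_bounded_ge0 phi.
(* The bound [M] shows that the set defining [opnorm] is bounded above, so its [sup] is a genuine
   upper bound. *)
have unit_le z : rnorm z <= 1 -> rnorm (phi z) <= opnorm phi.
  move=> z1; apply: ub_le_sup; last by exists z.
  exists M => _ [w w1 <-]; apply: le_trans (MP _) _.
  by rewrite ler_piMr.
have [x0|x0] := eqVneq (rnorm x) 0.
  by rewrite (rnorm_eq0 x0) linear0 !rnorm0 mulr0.
have [k kE xE] := rnorm_neq0 x0.
have k1 : rnorm (k *: x) = 1 by rewrite rnormZ kE mulVf.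
move: (k *: x) k1 xE => z z1 ->.
rewrite linearZ /= !rnormZ z1 mulr1 mulrC ler_wpM2r ?rnorm_ge0//.
by rewrite unit_le ?z1.
Qed.

Lemma opnorm_le phi M : 0 <= M ->
  (forall x, rnorm (phi x) <= M * rnorm x) -> opnorm phi <= M.
Proof.
move=> M0 MP; apply: ge_sup; first by exists (rnorm (phi 0)), 0; rewrite //= rnorm0.
by move=> _ [x /= x1 <-]; apply: le_trans (MP _) _; rewrite ler_piMr.
Qed.

Lemma opnorm_ge0 phi : 0 <= opnorm phi.
Proof.
apply: ub_le_sup; last by exists 0; rewrite /= ?linear0 ?rnorm0.
have [M M0 MP] := blin_bounded_ge0 phi.
exists M => _ [x /= x1 <-]; apply: le_trans (MP _) _.
by rewrite ler_piMr.
Qed.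

Lemma opnorm_subC phi psi : opnorm (blin_sub phi psi) = opnorm (blin_sub psi phi).
Proof.
by apply/le_anti/andP; split; apply: opnorm_le (opnorm_ge0 _) _ => x;
  rewrite [leLHS]rnormB; exact: (rnorm_le_opnorm (blin_sub _ _) x).
Qed.

End OperatorNorm.

(** * Norm and rank of the operators [tensor f y] *)

Section Tensor.
Variables X Y : normedModType K.

Lemma opnorm_tensor (f : dual X) (y : Y) :
  opnorm (tensor f y) = opnorm f * rnorm y.
Proof.
apply/le_anti/andP; split.
  apply: opnorm_le => [|x]; first by rewrite mulr_ge0 ?opnorm_ge0 ?rnorm_ge0.
  rewrite rnormZ mulrAC ler_wpM2r ?rnorm_ge0//; exact: rnorm_le_opnorm.
have [->|y0] := eqVneq (rnorm y) 0; first by rewrite mulr0 opnorm_ge0.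
have yp : 0 < rnorm y by rewrite lt0r y0 rnorm_ge0.
(* For nonzero [y], the norm of [f x] is that of [tensor f y x] divided by [rnorm y]. *)
rewrite -ler_pdivlMr//; apply: opnorm_le.
  by rewrite divr_ge0 ?opnorm_ge0 ?rnorm_ge0.
move=> x; rewrite mulrAC ler_pdivlMr//.
by have := rnorm_le_opnorm (tensor f y) x; rewrite rnormZ.
Qed.

(** The range is either zero, with the empty basis, or the line spanned by [y]. *)
Lemma rank_lt_tensor (f : dual X) (y : Y) n : (2 <= n)%N -> rank_lt (tensor f y) n.
Proof.
move=> n2.
have [fy0|] := pselect (forall x, (f x : K) *: y = 0).
  exists 0%N; first exact: ltn_trans n2.
  exists (fun=> 0); split=> [k _ []//|].
  apply/seteqP; split=> [_ [x _ <-]|_ [k ->]] /=.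
    by exists (fun=> 0); rewrite big_ord0 /tensor_fun fy0.
  by exists 0 => //; rewrite big_ord0 /tensor_fun fy0.
move=> /existsNP[x /eqP]; rewrite scaler_eq0 negb_or => /andP[fx0 y0].
exists 1%N => //; exists (fun=> y); split=> [k|].
  rewrite big_ord1 => /eqP; rewrite scaler_eq0 (negbTE y0) orbF => /eqP k0 i.
  by rewrite ord1.
apply/seteqP; split=> [_ [z _ <-]|_ [k ->]] /=.
  by exists (fun=> f z); rewrite big_ord1.
(* As [f x] is nonzero, this multiple of [x] is a preimage of [k ord0 *: y]. *)
exists ((k ord0 / f x : K) *: x) => //.
rewrite big_ord1 /tensor_fun linearZ /=; congr (_ *: _); exact: divfK.
Qed.

End Tensor.

(** The limit is built pointwise, using completeness of [Y]; the Cauchy estimates, uniform up to the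
    factor [rnorm x], survive the passage to the limit. *)
Lemma opnorm_complete (X : normedModType K) (Y : completeNormedModType K)
    (u : nat -> blin X Y) :
  (forall e : R, 0 < e -> exists N : nat, forall m n : nat,
     (N <= m)%N -> (N <= n)%N -> opnorm (blin_sub (u n) (u m)) < e) ->
  exists phi : blin X Y, opnorm (blin_sub (u n) phi) @[n --> \oo] --> (0 : R).
Proof.
move=> uc.
have dist_le N e : (forall m n, (N <= m)%N -> (N <= n)%N ->
      opnorm (blin_sub (u n) (u m)) < e) ->
    forall m n x, (N <= m)%N -> (N <= n)%N -> rnorm (u n x - u m x) <= e * rnorm x.
  move=> NP m n x Nm Nn.
  apply: le_trans (rnorm_le_opnorm (blin_sub (u n) (u m)) x) _.
  by rewrite ler_wpM2r ?rnorm_ge0 ?(ltW (NP _ _ _ _)).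
have u_cvg x : cvg (u n x @[n --> \oo]).
  apply: rnorm_cauchy_cvg => e e0.
  (* Adding 1 keeps the divisor positive when [x] is zero. *)
  have x1 : 0 < rnorm x + 1 by rewrite ltr_wpDl ?rnorm_ge0.
  have [|N /dist_le NP] := uc (e / (rnorm x + 1)); first by rewrite divr_gt0.
  exists N => m n Nm Nn; apply: le_lt_trans (NP _ _ _ Nm Nn) _.
  by rewrite mulrAC ltr_pdivrMr// ltr_pM2l// ltrDl.
pose f x := lim (u n x @[n --> \oo]).
have f_lin : linear f.
  move=> k x y; apply: cvg_lim; first exact: norm_hausdorff.
  under eq_fun do rewrite linearP.
  by apply: cvgD; [apply: cvgZl_tmp|]; exact: u_cvg.
have f_dist N e : (forall m n, (N <= m)%N -> (N <= n)%N ->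
      opnorm (blin_sub (u n) (u m)) < e) ->
    forall n x, (N <= n)%N -> rnorm (u n x - f x) <= e * rnorm x.
  move=> /dist_le NP n x Nn; apply/ler_addgt0Pr => d d0.
  (* The index [maxn M N] is late enough both for the Cauchy bound and for being within [d] of the
     limit; [d] is arbitrary. *)
  have /cvg_rnormP/(_ _ d0)[M _ MP] := u_cvg x.
  have := MP (maxn M N) (leq_maxl _ _); rewrite rnormB => /ltW md.
  rewrite -[u n x](subrK (u (maxn M N) x)) -addrA.
  by apply: le_trans (rnormD _ _) _; rewrite lerD// NP// leq_maxr.
pose F : {linear X -> Y} := HB.pack f (GRing.isLinear.Build K X Y *:%R f f_lin).
have F_bounded : exists M : R, forall x, rnorm (F x) <= M * rnorm x.
  (* One member of the sequence within distance 1 of the limit suffices to bound the limit. *)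
  have [N NP] := uc 1 ltr01.
  exists (1 + opnorm (u N)) => x; rewrite -[F x](subrK (u N x)) mulrDl.
  apply: le_trans (rnormD _ _) _.
  by rewrite lerD ?rnorm_le_opnorm// rnormB; exact: f_dist NP _ _ _.
exists (BLin F_bounded); apply/cvgrPdist_le => e e0.
have [N NP] := uc _ e0; exists N => // n Nn.
rewrite /= sub0r normrN ger0_norm ?opnorm_ge0//.
by apply: opnorm_le => [|x]; [exact: ltW|exact: f_dist NP _ _ _].
Qed.

End RealNormedSpaces.

(** * Partial sums of s-numbers *)

Section SNumberIdeal.
Variables (R : realType) (c : scalars) (a r : nat -> R).
Local Notation K := (scalar_field R c).
Local Notation banach := (completeNormedModType K).
Variable s : forall X Y : banach, blin X Y -> nat -> R.
Arguments s {X Y}.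
Hypotheses (s_num : is_snumber (@s)).

Local Notation sum_s phi i := (\sum_(1 <= j < i.+1) s phi j).
Local Notation weighted phi i := (a i * sum_s phi i * r i).

Lemma snumber_le_opnorm (X Y : banach) (phi : blin X Y) n :
  (1 <= n)%N -> s phi n <= opnorm phi.
Proof.
case: n => // n _; elim: n => [|n IHn]; first by rewrite (snumber_1 s_num).
exact: le_trans (snumber_noninc s_num phi _) IHn.
Qed.

(** Additivity is applied to [psi] and [phi - psi] with second index 1, where the s-number is the
    operator norm. *)
Lemma snumber_lipschitz (X Y : banach) (phi psi : blin X Y) n :
  (1 <= n)%N -> s phi n <= s psi n + opnorm (blin_sub phi psi).
Proof.
move=> n1; have phiE : phi = blin_add psi (blin_sub phi psi).
  by apply: blin_ext => x /=; rewrite addrC subrK.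
rewrite {1}phiE.
have := snumber_add s_num psi (blin_sub phi psi) n1 (leqnn 1).
by rewrite addnK (snumber_1 s_num).
Qed.

Lemma snumber_sum_ge0 (X Y : banach) (phi : blin X Y) i : 0 <= sum_s phi i.
Proof.
by rewrite big_nat_cond sumr_ge0// => j /andP[/andP[j1 _] _]; exact: snumber_ge0.
Qed.

(* Both s_{2j-1} and s_{2j} of a sum are at most s_j(phi) + s_j(psi), so pairing
   the first 2i terms gives the factor 2. *)
Lemma snumber_sum_add (X Y : banach) (phi psi : blin X Y) i :
  sum_s (blin_add phi psi) i <= 2 * (sum_s phi i + sum_s psi i).
Proof.
apply: (@le_trans _ _ (sum_s (blin_add phi psi) i.*2)).
  rewrite [leRHS](@big_cat_nat _ _ _ i.+1) ?ltnS -?addnn ?leq_addr//= lerDl.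
  rewrite big_nat_cond sumr_ge0// => j /andP[/andP[ij _] _].
  by apply: (snumber_ge0 s_num); apply: leq_trans ij.
elim: i => [|i IHi]; first by rewrite !big_geq// addr0 mulr0.
rewrite doubleS (@big_nat_recr _ _ _ i.*2.+2)// (@big_nat_recr _ _ _ i.*2.+1)//=.
rewrite !(@big_nat_recr _ _ _ i.+1)//=.
have := snumber_add s_num phi psi (ltn0Sn i) (ltn0Sn i).
rewrite addnS subn1 /= addSn addnn => odd_le.
have := snumber_noninc s_num (blin_add phi psi) (ltn0Sn i.*2).
lra.
Qed.

Lemma snumber_sum_comp (X0 X Y Y0 : banach)
    (zeta : blin Y Y0) (phi : blin X Y) (eta : blin X0 X) i :
  sum_s (blin_comp zeta (blin_comp phi eta)) i
  <= opnorm zeta * sum_s phi i * opnorm eta.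
Proof.
rewrite mulr_sumr mulr_suml; apply: ler_sum_nat => j /andP[j1 _].
exact: snumber_comp.
Qed.

(** The rank is at most 1, so only the first s-number survives. *)
Lemma snumber_sum_tensor (X Y : banach) (f : dual X) (y : Y) i : (1 <= i)%N ->
  sum_s (tensor f y) i = opnorm f * rnorm y.
Proof.
move=> i1; rewrite big_ltn// (snumber_1 s_num) opnorm_tensor big_nat_cond big1 ?addr0//.
move=> j /andP[/andP[j2 _] _].
by apply: (snumber_rank s_num); [exact: ltnW|exact: rank_lt_tensor].
Qed.

(** * Weighted partial sums *)

Hypotheses (a_gt0 : forall n, (1 <= n)%N -> 0 < a n)
  (r_gt0 : forall n, (1 <= n)%N -> 0 < r n).
Variable C : R.
Hypothesis weight_le : forall i, (1 <= i)%N -> i%:R * (a i * r i) <= C.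

Let weight_gt0 i : (1 <= i)%N -> 0 < a i * r i.
Proof. by move=> i1; rewrite mulr_gt0 ?a_gt0 ?r_gt0. Qed.

Let C_ge0 : 0 <= C.
Proof.
by apply: le_trans (weight_le (leqnn 1)); rewrite mul1r ltW ?weight_gt0.
Qed.

(** At index 0 the signs of [a] and [r] are unknown, but the empty sum makes the term zero. *)
Lemma weighted_ge0 (X Y : banach) (phi : blin X Y) i : 0 <= weighted phi i.
Proof.
case: i => [|i]; first by rewrite big_geq// mulr0 mul0r.
by rewrite mulr_ge0 ?mulr_ge0 ?snumber_sum_ge0// ltW ?a_gt0 ?r_gt0.
Qed.

Lemma normr_weighted (X Y : banach) (phi : blin X Y) i : (1 <= i)%N ->
  `|a i * sum_s phi i| * r i = weighted phi i.
Proof.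
by move=> i1; rewrite ger0_norm// mulr_ge0 ?snumber_sum_ge0// ltW ?a_gt0.
Qed.

(** Summing [snumber_lipschitz] over [i] terms costs a factor [i], which the weight absorbs into
    [C]; the constant is thus uniform in [i]. *)
Lemma weighted_lipschitz (X Y : banach) (phi psi : blin X Y) i :
  weighted phi i <= weighted psi i + C * opnorm (blin_sub phi psi).
Proof.
case: i => [|i]; first by rewrite !big_geq// mulr0 mul0r add0r mulr_ge0 ?opnorm_ge0.
have sum_le : sum_s phi i.+1 <= sum_s psi i.+1 + i.+1%:R * opnorm (blin_sub phi psi).
  rewrite mulr_natl -[X in _ *+ X]subn0 -subSS -sumr_const_nat -big_split /=.
  by apply: ler_sum_nat => j /andP[j1 _]; exact: snumber_lipschitz.
have {sum_le}/(ler_wpM2l (ltW (weight_gt0 (ltn0Sn i)))) := sum_le.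
have /(ler_wpM2r (opnorm_ge0 (blin_sub phi psi))) := weight_le (ltn0Sn i).
nra.
Qed.

Lemma weighted_le_opnorm (X Y : banach) (phi : blin X Y) i : (1 <= i)%N ->
  weighted phi i <= C * opnorm phi.
Proof.
move=> i1.
have sum_le : sum_s phi i <= i%:R * opnorm phi.
  rewrite mulr_natl -[X in _ *+ X]subn0 -subSS -sumr_const_nat.
  by apply: ler_sum_nat => j /andP[j1 _]; exact: snumber_le_opnorm.
have {sum_le}/(ler_wpM2l (ltW (weight_gt0 i1))) := sum_le.
have /(ler_wpM2r (opnorm_ge0 phi)) := weight_le i1.
nra.
Qed.

Lemma weighted_add (X Y : banach) (phi psi : blin X Y) i :
  weighted (blin_add phi psi) i <= 2 * (weighted phi i + weighted psi i).
Proof.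
case: i => [|i]; first by rewrite !big_geq// mulr0 mul0r addr0 mulr0.
have /(ler_wpM2l (ltW (weight_gt0 (ltn0Sn i)))) := snumber_sum_add phi psi i.+1.
nra.
Qed.

Lemma weighted_comp (X0 X Y Y0 : banach)
    (zeta : blin Y Y0) (phi : blin X Y) (eta : blin X0 X) i :
  weighted (blin_comp zeta (blin_comp phi eta)) i
  <= opnorm zeta * weighted phi i * opnorm eta.
Proof.
case: i => [|i]; first by rewrite !big_geq// mulr0 !mul0r mulr0 mul0r.
have /(ler_wpM2l (ltW (weight_gt0 (ltn0Sn i)))) := snumber_sum_comp zeta phi eta i.+1.
nra.
Qed.

(** * Membership in the class and two-sided bounds for [Qs] *)

Lemma chiP (X Y : banach) (phi : blin X Y) : chi a r (@s) phi <->
  forall e : R, 0 < e -> \forall i \near \oo, weighted phi i <= e.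
Proof.
split=> [/cvgrPdist_le phi0 e e0|phi0].
  by apply: filterS (phi0 _ e0) => i; rewrite sub0r normrN ger0_norm ?weighted_ge0.
apply/cvgrPdist_le => e e0; apply: filterS (phi0 _ e0) => i.
by rewrite sub0r normrN ger0_norm ?weighted_ge0.
Qed.

Lemma Qs_le (X Y : banach) (phi : blin X Y) (M : R) :
  (forall i, (1 <= i)%N -> weighted phi i <= M) -> (Qs a r (@s) phi <= M%:E)%E.
Proof.
move=> phiM; apply: ge_ereal_sup => _ [i i1 <-].
by rewrite normr_weighted// lee_fin phiM.
Qed.

Lemma weighted_le_Qs (X Y : banach) (phi : blin X Y) i : (1 <= i)%N ->
  ((weighted phi i)%:E <= Qs a r (@s) phi)%E.
Proof.
by move=> i1; apply: ereal_sup_ubound; exists i => //; rewrite normr_weighted.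
Qed.

Lemma Qs_ge0 (X Y : banach) (phi : blin X Y) : (0 <= Qs a r (@s) phi)%E.
Proof.
by apply: le_trans (weighted_le_Qs phi (leqnn 1)); rewrite lee_fin weighted_ge0.
Qed.

Lemma Qs_le_opnorm (X Y : banach) (phi : blin X Y) :
  (Qs a r (@s) phi <= (C * opnorm phi)%:E)%E.
Proof. by apply: Qs_le => i; exact: weighted_le_opnorm. Qed.

(** This is the term of index 1 in the supremum. *)
Lemma opnorm_le_Qs (X Y : banach) (phi : blin X Y) :
  ((a 1 * r 1 * opnorm phi)%:E <= Qs a r (@s) phi)%E.
Proof.
apply: le_trans (weighted_le_Qs phi (leqnn 1)).
by rewrite lee_fin big_nat1 (snumber_1 s_num) mulrAC.
Qed.

Lemma Qs_fin_num (X Y : banach) (phi : blin X Y) : Qs a r (@s) phi \is a fin_num.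
Proof.
by rewrite ge0_fin_numE ?Qs_ge0//; apply: le_lt_trans (Qs_le_opnorm phi) (ltry _).
Qed.

Lemma weighted_le_fine_Qs (X Y : banach) (phi : blin X Y) i : (1 <= i)%N ->
  weighted phi i <= fine (Qs a r (@s) phi).
Proof. by move=> i1; rewrite -lee_fin fineK ?Qs_fin_num ?weighted_le_Qs. Qed.

(** * The ideal, the quasi-norm and completeness *)

Lemma chi_tensor (X Y : banach) (f : dual X) (y : Y) :
  chi a r (@s) (tensor f y).
Proof.
apply/chiP => e e0; near=> i.
have i1 : (1 <= i)%N by near: i; exact: nbhs_infty_ge.
have i0 : 0 < i%:R :> R by rewrite ltr0n.
have D0 : 0 <= opnorm f * rnorm y by rewrite mulr_ge0 ?opnorm_ge0 ?rnorm_ge0.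
(* The sum is constant in [i], while [a i * r i] is at most [C / i]; it remains to take [i]
   large. *)
rewrite snumber_sum_tensor// mulrAC -(ler_pM2l i0) mulrA.
apply: (@le_trans _ _ (C * (opnorm f * rnorm y))).
  by rewrite ler_wpM2r// weight_le.
rewrite -ler_pdivrMr//; near: i; exact: nbhs_infty_ger.
Unshelve. all: by end_near. Qed.

Lemma chi_operator_ideal : is_operator_ideal (chi a r (@s)).
Proof.
split.
- exact: chi_tensor.
- move=> X Y phi psi /chiP phi0 /chiP psi0; apply/chiP => e e0.
  (* Two summands and the factor 2 of [weighted_add] make up the 4. *)
  have e4 : 0 < e / 4 by rewrite divr_gt0.
  near=> i; apply: le_trans (weighted_add _ _ _) _.
  have phie : weighted phi i <= e / 4 by near: i; exact: phi0.
  have psie : weighted psi i <= e / 4 by near: i; exact: psi0.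
  lra.
- move=> X0 X Y Y0 zeta phi eta phi0.
  have bound0 : opnorm zeta * weighted phi i * opnorm eta @[i --> \oo] --> (0 : R).
    rewrite -[X in _ --> X](_ : opnorm zeta * 0 * opnorm eta = 0); last first.
      by rewrite mulr0 mul0r.
    by apply: cvgM (cvg_cst _); apply: cvgM (cvg_cst _) phi0.
  apply: (@squeeze_cvgr _ _ _ _ (fun=> 0) _ _ _ _ _ bound0); last exact: cvg_cst.
  by apply: nearW => i; rewrite weighted_ge0 weighted_comp.
Unshelve. all: by end_near. Qed.

Lemma Qs_quasi_norm :
  ereal_sup [set (`|a i| * r i)%:E | i in [set i : nat | (1 <= i)%N]] = 1%:E ->
  is_quasi_norm (chi a r (@s)) (Qs a r (@s)).
Proof.
move=> sup1; split.
- by move=> X Y phi _; exact: Qs_fin_num.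
- by move=> X Y phi _; exact: Qs_ge0.
- move=> X Y f y; have D0 : 0 <= opnorm f * rnorm y.
    by rewrite mulr_ge0 ?opnorm_ge0 ?rnorm_ge0.
  (* The factor 1 is replaced by the normalised supremum and [opnorm f * rnorm y] is moved inside,
     where the two suprema agree term by term. *)
  rewrite -[RHS]mule1 -sup1 -ereal_supZl//; last first.
    by apply/set0P; exists (`|a 1| * r 1)%:E, 1%N.
  rewrite image_comp; congr ereal_sup; apply: eq_imagel => i i1 /=.
  by rewrite normr_weighted// snumber_sum_tensor// gtr0_norm ?a_gt0// -EFinM mulrAC mulrC.
(* The constant comes from the pairing in [snumber_sum_add]. *)
- exists 2 => [|X Y phi psi _ _]; first by rewrite ler1n.
  rewrite -(fineK (Qs_fin_num phi)) -(fineK (Qs_fin_num psi)) -EFinD -EFinM.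
  apply: Qs_le => i i1; apply: le_trans (weighted_add _ _ _) _.
  by rewrite ler_pM2l// lerD ?weighted_le_fine_Qs.
- move=> X0 X Y Y0 zeta phi eta _.
  rewrite -(fineK (Qs_fin_num phi)) -!EFinM.
  apply: Qs_le => i i1; apply: le_trans (weighted_comp _ _ _ _) _.
  by rewrite ler_wpM2r ?opnorm_ge0// ler_wpM2l ?opnorm_ge0// weighted_le_fine_Qs.
Qed.

Lemma chi_quasi_complete : quasi_complete (chi a r (@s)) (Qs a r (@s)).
Proof.
move=> X Y u u_chi u_cauchy.
have ar1 : 0 < a 1 * r 1 by exact: weight_gt0.
have [e e0|phi u_phi] := @opnorm_complete R c X Y u.
  (* The tolerance is scaled because [Qs] dominates [a 1 * r 1] times the operator norm. *)
  have [N NP] := u_cauchy (a 1 * r 1 * e) (mulr_gt0 ar1 e0).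
  exists N => m n Nm Nn; rewrite -(ltr_pM2l ar1) -lte_fin.
  exact: le_lt_trans (opnorm_le_Qs _) (NP _ _ Nm Nn).
have Cu_phi : C * opnorm (blin_sub (u n) phi) @[n --> \oo] --> (0 : R).
  by rewrite -(mulr0 C); exact: cvgMl_tmp.
exists phi.
  apply/chiP => e e0; have e2 : 0 < e / 2 by rewrite divr_gt0.
  (* A single [n] is fixed with [u n] close to [phi]; half of [e] pays for that distance, the other
     half for the tail of [u n]. *)
  have /cvgrPdist_le/(_ _ e2)[n _ /(_ n (leqnn n))] := Cu_phi.
  rewrite sub0r normrN => /(le_trans (ler_norm _)) n_le.
  have /chiP/(_ _ e2) := u_chi n; apply: filterS => i un_le.
  apply: le_trans (weighted_lipschitz phi (u n) i) _.
  by rewrite opnorm_subC [leRHS]splitr lerD.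
have Cu_phiE : (C * opnorm (blin_sub (u n) phi))%:E @[n --> \oo] --> 0%E.
  by apply: cvg_EFin Cu_phi; exact: nearW.
apply: (@squeeze_cvge _ _ _ _ (fun=> 0%E) _ _ _ _ _ Cu_phiE); last exact: cvg_cst.
by apply: nearW => n; rewrite Qs_ge0 Qs_le_opnorm.
Qed.

End SNumberIdeal.

Theorem theorem5p9 (R : realType) (c : scalars) (a r : nat -> R)
    (s : forall X Y : completeNormedModType (scalar_field R c),
           blin X Y -> nat -> R) :
  (forall n, (1 <= n)%N -> 0 < a n) ->
  (exists2 l : R, l != 0 & n%:R * a n @[n --> \oo] --> l) ->
  (forall n, (1 <= n)%N -> 0 < r n) ->
  (exists M : R, forall n, (1 <= n)%N -> r n <= M) ->
  is_snumber s ->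
  ereal_sup [set (`|a i| * r i)%:E | i in [set i : nat | (1 <= i)%N]] = 1%:E ->
  is_operator_ideal (chi a r s) /\
  is_quasi_norm (chi a r s) (Qs a r s) /\
  quasi_complete (chi a r s) (Qs a r s).
Proof.
move=> a_gt0 [l _ na_l] r_gt0 [M rM] s_num sup1.
have [C weight_le] : exists C : R, forall i, (1 <= i)%N -> i%:R * (a i * r i) <= C.
  (* Boundedness provides every bound strictly above [B], whence [B + 1]; the product with the bound
     [M] of [r] gives [C]. *)
  have /cvg_seq_bounded[B [_ /(_ (B + 1))]] := cvgP _ na_l.
  rewrite ltrDl => /(_ ltr01) na_le.
  exists ((B + 1) * M) => i i1; rewrite mulrA.
  have ia0 : 0 <= i%:R * a i by rewrite mulr_ge0 ?ler0n// ltW ?a_gt0.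
  have /= := na_le i I; rewrite ger0_norm// => na_i.
  by apply: ler_pM => //; [exact: ltW (r_gt0 _ i1)|exact: rM].
split; [|split].
- exact: chi_operator_ideal weight_le.
- exact: Qs_quasi_norm weight_le sup1.
- exact: chi_quasi_complete weight_le.
Qed.
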